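(* Let $\mathbb{K}$ be a field, $n,d\ge1$ and $k\ge0$ integers. The compact Betti diagram of the Veronese module $S_{n,d,k}$ over $R$ has at most $n$ rows; that is, $\beta_{p,\,k+(p+i)d}(S_{n,d,k})=0$ for every $p\ge 0$ and every integer $i$ not satisfying $0\le i\le n-1$.
   Context: $S=\mathbb{K}[x_1,\dots,x_n]=\bigoplus_{j\ge0}S_j$ with the standard grading, and $S_{n,d,k}=\bigoplus_{i\ge0}S_{k+id}$. $\mathcal{A}=\{\mathbf{a}\in\mathbb{N}^n:\sum_i a_i=d\}=\{\mathbf{a}_1,\dots,\mathbf{a}_N\}$ with $N=\binom{d+n-1}{d}$. $R=\mathbb{K}[y_1,\dots,y_N]$, with $\deg y_i=d$, acts on $S_{n,d,k}$ via $y_i\mapsto\mathbf{x}^{\mathbf{a}_i}$; elements of $S_{k+id}$ have degree $k+id$. $\beta_{p,j}(M)=\dim_{\mathbb{K}}\operatorname{Tor}_p^R(M,\mathbb{K})_j$; these vanish for $M=S_{n,d,k}$ unless $j\equiv k \pmod d$. The compact Betti diagram is the table whose entry in column $p$ and in the row labelled $k+i$ is $\beta_{p,k+(p+i)d}(S_{n,d,k})$. *)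

(* Defs.v *)
From HB Require Import structures.
From mathcomp Require Import all_boot all_order all_algebra.
From mathcomp.multinomials Require Import freeg mpoly.

Set Implicit Arguments.
Unset Strict Implicit.
Unset Printing Implicit Defensive.

Import Order.TTheory GRing.Theory Num.Theory.
Local Open Scope ring_scope.

(* Z-graded modules over K[y_1, ..., y_N], where every y_i has degree w; thus
   a polynomial that is e-homogeneous in the usual sense has degree w * e. *)
Record gradedModule (K : fieldType) (N w : nat) := GradedModule {
  gm_sort :> lmodType {mpoly K[N]};
  gm_homog : int -> {pred gm_sort};
  gm_homogB : forall j x y,
    x \in gm_homog j -> y \in gm_homog j -> x - y \in gm_homog j;
  gm_homogZ : forall e j (p : {mpoly K[N]}) x,
    p \is e.-homog -> x \in gm_homog j -> p *: x \in gm_homog (j + (w * e)%:Z);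
  gm_decomp : forall x, exists (s : seq int) (f : int -> gm_sort),
    [/\ uniq s, forall j, f j \in gm_homog j & x = \sum_(j <- s) f j];
  gm_direct : forall (s : seq int) (f : int -> gm_sort),
    uniq s -> (forall j, f j \in gm_homog j) -> \sum_(j <- s) f j = 0 ->
    {in s, forall j, f j = 0}
}.
Arguments gm_homog {K N w} g j.

Definition graded_hom (K : fieldType) (N w : nat) (M M' : gradedModule K N w)
    (f : M -> M') : Prop :=
  forall j x, x \in gm_homog M j -> f x \in gm_homog M' j.

(* The graded free module with basis B, the basis vector b having degree
   deg b. *)
Section GradedFree.
Context (K : fieldType) (N w : nat) (B : choiceType) (deg : B -> int).
Local Notation R := {mpoly K[N]}.
Local Notation F := {freeg B / R}.

Definition free_homog (j : int) : {pred F} :=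
  fun u => all (fun b =>
    all (fun m => deg b + (w * mdeg m)%:Z == j) (msupp (coeff b u))) (dom u).

Lemma free_homogP j (u : F) :
  reflect (forall b m, deg b + (w * mdeg m)%:Z != j -> (coeff b u)@_m = 0)
          (u \in free_homog j).
Proof.
apply: (iffP allP) => [h b m nj | h b _].
  apply/eqP; rewrite mcoeff_eq0; apply: contra nj => mb.
  have bu : b \in dom u.
    by rewrite mem_dom; apply: contraTneq mb => ->; rewrite msupp0.
  by move/allP: (h _ bu) => /(_ _ mb).
apply/allP => m; rewrite mcoeff_msupp; apply: contraR => /h -> //.
Qed.

Lemma free_homogB j (u v : F) :
  u \in free_homog j -> v \in free_homog j -> u - v \in free_homog j.
Proof.
move=> /free_homogP hu /free_homogP hv; apply/free_homogP => b m nj.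
by rewrite coeffB mcoeffB hu // hv // subr0.
Qed.

Lemma free_homogZ e j (p : R) (u : F) :
  p \is e.-homog -> u \in free_homog j ->
  p *: u \in free_homog (j + (w * e)%:Z).
Proof.
move=> /dhomogP hp /free_homogP hu; apply/free_homogP => b m nj.
rewrite coeffZ; apply/eqP; rewrite mcoeff_eq0; apply: contra nj.
case/msuppM_le/allpairsP => -[m1 m2] /= [/hp e1 h2 ->].
have -> : j = deg b + (w * mdeg m2)%:Z.
  by apply/eqP; move: h2; rewrite mcoeff_msupp; apply: contraR;
     rewrite eq_sym => /hu ->.
by rewrite mdegD -e1 mulnDr PoszD -addrA [X in _ + X]addrC.
Qed.

Lemma free_decomp (u : F) : exists (s : seq int) (f : int -> F),
  [/\ uniq s, forall j, f j \in free_homog j & u = \sum_(j <- s) f j].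
Proof.
pose s := undup (flatten [seq [seq deg b + (w * mdeg m)%:Z |
                               m <- msupp (coeff b u)] | b <- dom u]).
pose f j := \sum_(b <- dom u) \sum_(m <- msupp (coeff b u) |
  deg b + (w * mdeg m)%:Z == j) << (coeff b u)@_m *: 'X_[m] *g b >> : F.
exists s, f; split; first exact: undup_uniq.
  move=> j; apply/free_homogP => b m nj.
  rewrite raddf_sum raddf_sum big1 //= => b' _.
  rewrite raddf_sum raddf_sum big1 //= => m' /eqP ej.
  rewrite coeffU; case: eqVneq => [eb | _]; last by rewrite mulr0 mcoeff0.
  rewrite mulr1 mcoeffZ mcoeffX; case: eqVneq => [em | _]; last by rewrite mulr0.
  by rewrite -eb -em ej eqxx in nj.
rewrite /f exchange_big /= -[LHS]freeg_sumE big_seq [RHS]big_seq.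
apply: eq_bigr => b bu; rewrite (exchange_big_dep xpredT) //=.
rewrite {1}[coeff b u]mpolyE.
have hsum (r : seq 'X_{1..N}) (G : 'X_{1..N} -> R) :
    << \sum_(m <- r) G m *g b >> = \sum_(m <- r) << G m *g b >> :> F.
  elim: r => [|m r IH]; first by rewrite !big_nil freegU0.
  by rewrite !big_cons -freegUD IH.
rewrite hsum big_seq [RHS]big_seq; apply: eq_bigr => m mb.
have ms : deg b + (w * mdeg m)%:Z \in s.
  rewrite mem_undup; apply/flattenP.
  by exists [seq deg b + (w * mdeg m)%:Z | m <- msupp (coeff b u)];
    apply/mapP; [exists b | exists m].
rewrite -big_filter (eq_filter (a2 := pred1 (deg b + (w * mdeg m)%:Z))).
  by rewrite (filter_pred1_uniq (undup_uniq _) ms) big_seq1.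
by move=> j; rewrite /= eq_sym.
Qed.

Lemma free_direct (s : seq int) (f : int -> F) :
  uniq s -> (forall j, f j \in free_homog j) -> \sum_(j <- s) f j = 0 ->
  {in s, forall j, f j = 0}.
Proof.
move=> us hf s0 j js; apply/eqP/freeg_eqP => b; rewrite coeff0.
apply/mpolyP => m; rewrite mcoeff0.
have [ej | nj] := eqVneq (deg b + (w * mdeg m)%:Z) j; last first.
  by move/free_homogP: (hf j) => ->.
have /(congr1 (fun v => (coeff b v)@_m)) := s0.
rewrite coeff0 mcoeff0 raddf_sum raddf_sum /= (bigD1_seq j) //= big1 ?addr0 //.
move=> i ij; move/free_homogP: (hf i) => -> //.
by rewrite ej eq_sym.
Qed.

Definition graded_free : gradedModule K N w :=
  GradedModule free_homogB free_homogZ free_decomp free_direct.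

End GradedFree.

(* Graded free resolutions ... -> F_1 -> F_0 -> M -> 0, of arbitrary ranks,
   with degree-preserving maps. *)
Record freeResolution (K : fieldType) (N w : nat) (M : gradedModule K N w) :=
  FreeResolution {
  res_basis : nat -> choiceType;
  res_deg : forall p, res_basis p -> int;
  res_mod := fun p => graded_free K N w (@res_deg p);
  res_diff : forall p, {linear res_mod p.+1 -> res_mod p};
  res_aug : {linear res_mod 0 -> M};
  res_diff_hom : forall p, graded_hom (res_diff p);
  res_aug_hom : graded_hom res_aug;
  res_aug_surj : forall x, exists u, res_aug u = x;
  res_exact0 : forall u, res_aug u = 0 <-> exists v, u = res_diff 0 v;
  res_exactS : forall p u, res_diff p u = 0 <-> exists v, u = res_diff p.+1 v
}.

(* Existence of resolutions: F_0 has a basis vector for every homogeneous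
   element of M, and F_{p+1} one for every homogeneous cycle of F_p. *)
Section Existence.
Context (K : fieldType) (N w : nat).
Local Notation R := {mpoly K[N]}.
Implicit Type M : gradedModule K N w.

Lemma fglift_sum (A : nzRingType) (B : choiceType) (V : lmodType A) (f : B -> V)
    (u : {freeg B / A}) :
  fglift f u = \sum_(b <- dom u) coeff b u *: f b.
Proof.
pose g := GRing.isZmodMorphism.Build _ _ (fglift f) (@lift_is_additive A B V f).
pose h : {additive {freeg B / A} -> V} := HB.pack (fglift f) g.
rewrite -[LHS]/(h u) -{1}(freeg_sumE u) raddf_sum.
by apply: eq_bigr => b _; exact: liftU.
Qed.

Lemma fglift_linear (A : nzRingType) (B : choiceType) (V : lmodType A)
    (f : B -> V) : linear (fglift f).
Proof.
have sumw (u : {freeg B / A}) (s : seq B) : uniq s -> {subset dom u <= s} ->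
    fglift f u = \sum_(b <- s) coeff b u *: f b.
  move=> us hs; rewrite fglift_sum [RHS](bigID (mem (dom u))) /=.
  rewrite [X in _ + X]big1 ?addr0 => [|b]; last first.
    by move/coeff_outdom ->; rewrite scale0r.
  rewrite -[RHS]big_filter; apply: perm_big; apply: uniq_perm.
  - exact: uniq_dom.
  - exact: filter_uniq.
  - by move=> b; rewrite mem_filter /= andb_idr //; exact: hs.
move=> a u v; pose s := undup (dom u ++ dom v).
have us : uniq s by exact: undup_uniq.
rewrite (sumw _ _ us) => [|b /domD_subset]; last first.
  rewrite mem_undup !mem_cat => /orP[/domZ_subset -> // | -> ].
  by rewrite orbT.
rewrite (sumw u _ us) => [|b bu]; last by rewrite mem_undup mem_cat bu.
rewrite (sumw v _ us) => [|b bu]; last by rewrite mem_undup mem_cat bu orbT.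
rewrite scaler_sumr -big_split /=; apply: eq_bigr => b _.
by rewrite coeffD coeffZ scalerDl scalerA.
Qed.

Lemma gm_homog0 M j : 0 \in gm_homog M j.
Proof.
have [s [f [_ hf _]]] := gm_decomp (0 : M).
by rewrite -(subrr (f j)) gm_homogB.
Qed.

Lemma gm_homog_sum M j (I : Type) (r : seq I) (P : pred I) (f : I -> M) :
  (forall i, P i -> f i \in gm_homog M j) ->
  \sum_(i <- r | P i) f i \in gm_homog M j.
Proof.
move=> hf; apply: (big_ind (fun x : M => x \in gm_homog M j)) => //
  [|x y hx hy]; first exact: gm_homog0.
rewrite -[y]opprK; apply: (gm_homogB hx).
by rewrite -sub0r; apply: (gm_homogB (gm_homog0 M j)).
Qed.

Section Cover.
Context (M : gradedModule K N w) (W : {pred M}).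
Context (W_closed : submod_closed W).
Context (W_graded : forall (s : seq int) (f : int -> M), uniq s ->
  (forall j, f j \in gm_homog M j) -> \sum_(j <- s) f j \in W ->
  {in s, forall j, f j \in W}).

Definition cover_gen (b : M * int) : M :=
  if (b.1 \in gm_homog M b.2) && (b.1 \in W) then b.1 else 0.
Definition cover_mod : gradedModule K N w :=
  graded_free K N w (fun b : M * int => b.2).
Definition cover_fun : cover_mod -> M := fglift cover_gen.
HB.instance Definition _ :=
  GRing.isLinear.Build R cover_mod M _ cover_fun (fglift_linear cover_gen).
Definition cover : {linear cover_mod -> M} := cover_fun.

Lemma cover_hom : graded_hom cover.
Proof.
move=> j u /free_homogP hu; rewrite /cover /= /cover_fun fglift_sum.
apply: gm_homog_sum => b _; rewrite [coeff b u]mpolyE scaler_suml.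
rewrite big_seq; apply: gm_homog_sum => m mb.
have <- : b.2 + (w * mdeg m)%:Z = j.
  by apply/eqP; move: mb; rewrite mcoeff_msupp; apply: contraR => /hu ->.
apply: gm_homogZ; first by rewrite dhomogZ // dhomogX.
by rewrite /cover_gen; case: ifP => [/andP[] // | _]; exact: gm_homog0.
Qed.

Lemma cover_image x : x \in W <-> exists u, x = cover u.
Proof.
have [W0 WZ] := W_closed.
have WD y z : y \in W -> z \in W -> y + z \in W.
  by move=> hy hz; rewrite -[y]scale1r; exact: WZ.
split=> [xW | [u ->]]; last first.
  rewrite /cover /= /cover_fun fglift_sum.
  apply: (big_ind (fun x : M => x \in W)) => // b _.
  rewrite -[_ *: _]addr0; apply: WZ => //.
  by rewrite /cover_gen; case: ifP => [/andP[] | _].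
have [s [f [us hf ex]]] := gm_decomp x.
have fW : {in s, forall j, f j \in W} by apply: W_graded => //; rewrite -ex.
exists (\sum_(j <- s) << (f j, j) >>); rewrite raddf_sum ex.
rewrite big_seq [RHS]big_seq; apply: eq_bigr => j js.
by rewrite /cover /= /cover_fun liftU scale1r /cover_gen hf fW.
Qed.
End Cover.

Lemma ker_closed (M M' : gradedModule K N w) (f : {linear M -> M'}) :
  submod_closed [pred x : M | f x == 0].
Proof.
split=> [|a x y]; rewrite !inE ?linear0 // linearP => /eqP-> /eqP->.
by rewrite scaler0 addr0.
Qed.

Lemma ker_graded (M M' : gradedModule K N w) (f : {linear M -> M'}) :
  graded_hom f -> forall (s : seq int) (g : int -> M), uniq s ->
  (forall j, g j \in gm_homog M j) ->
  \sum_(j <- s) g j \in [pred x : M | f x == 0] ->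
  {in s, forall j, g j \in [pred x : M | f x == 0]}.
Proof.
move=> hf s g us hg; rewrite inE raddf_sum => /eqP e j js.
by rewrite inE (gm_direct us _ e js) // => i; exact: hf.
Qed.

(* A graded free module together with a graded map out of it. *)
Record stage := Stage {
  st_basis : choiceType;
  st_deg : st_basis -> int;
  st_target : gradedModule K N w;
  st_map : {linear graded_free K N w st_deg -> st_target};
  st_hom : graded_hom st_map
}.

Definition st_ker (s : stage) : {pred graded_free K N w (@st_deg s)} :=
  [pred u | st_map s u == 0].

Definition st_next (s : stage) : stage :=
  Stage (cover_hom (st_ker (s := s))).

Lemma free_resolution_exists M : exists F : freeResolution M, True.
Proof.
pose s0 := Stage (cover_hom [pred x : M | true]).
pose S p := iter p st_next s0.
have W_closed (s : stage) : submod_closed (st_ker (s := s)) := ker_closed _.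
have ex (s : stage) u : st_map s u = 0 <-> exists v, u = st_map (st_next s) v.
  rewrite -(cover_image (W_closed s) (ker_graded (@st_hom s))) inE.
  by split=> /eqP.
unshelve eexists (@FreeResolution K N w M (fun p => st_basis (S p))
  (fun p => @st_deg (S p)) (fun p => st_map (S p.+1)) (st_map s0)
  _ _ _ _ _) => //.
- by move=> p; exact: (@st_hom (S p.+1)).
- exact: (@st_hom s0).
- move=> x.
  have [|s f _ _ _ j _ //|+ _] := @cover_image M [pred x : M | true] _ _ x.
    by split=> // a y z.
  by case=> // u ->; exists u.
- exact: (ex s0).
- by move=> p; exact: (ex (S p.+1)).
Qed.
End Existence.

(* The K-vector space Z / B, for subspaces B of Z of an ambient space V, has
   finite dimension b: some family of b vectors of Z is a basis modulo B. *)
Definition quotient_dim (K : fieldType) (V : lmodType K) (Z B : V -> Prop)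
    (b : nat) : Prop :=
  exists e : 'I_b -> V, (forall l, Z (e l)) /\
    (forall z, Z z -> exists! c : 'rV[K]_b, B (z - \sum_l c 0 l *: e l)).

(* Tor^R(M, K) is the homology of F (x)_R K, where F is a graded free
   resolution of M and K = R / (y_1, ..., y_N).  The term F_p (x)_R K is the
   K-vector space on the same basis, and the differential of F (x)_R K is
   obtained by taking constant terms of the entries of that of F. *)
Section Tor.
Context (K : fieldType) (N w : nat) (M : gradedModule K N w).
Context (F : freeResolution M).

Definition const_part (B : choiceType) (u : {freeg B / {mpoly K[N]}}) :
    {freeg B / K} :=
  \sum_(b <- dom u) << (coeff b u)@_0 *g b >>.

Definition tensor_diff (p : nat) :
    {freeg (res_basis F p.+1) / K} -> {freeg (res_basis F p) / K} :=
  fglift (fun b => const_part (res_diff F p << b >>)).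

Definition tensor_homog (p : nat) (j : int) : {pred {freeg (res_basis F p) / K}} :=
  fun u => all (fun b => res_deg b == j) (dom u).

Definition tor_cycle (p : nat) (j : int) :
    {freeg (res_basis F p) / K} -> Prop :=
  match p with
  | 0 => fun u => u \in tensor_homog j
  | q.+1 => fun u => u \in tensor_homog j /\ tensor_diff u = 0
  end.

Definition tor_boundary (p : nat) (j : int) (u : {freeg (res_basis F p) / K}) :
    Prop :=
  exists2 v, v \in tensor_homog j & u = tensor_diff v.

End Tor.

(* beta_{p,j}(M) = dim_K Tor_p^R(M, K)_j is equal to b, Tor being computed by
   any graded free resolution of M (one exists by free_resolution_exists). *)
Definition betti_is (K : fieldType) (N w : nat) (M : gradedModule K N w)
    (p : nat) (j : int) (b : nat) : Prop :=
  forall F : freeResolution M,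
    quotient_dim (@tor_cycle _ _ _ _ F p j) (@tor_boundary _ _ _ _ F p j) b.

(* The exponents a_1, ..., a_N of the monomials of degree d in n variables. *)
Definition veronese_exps (n d : nat) : seq 'X_{1..n} :=
  [seq val m | m <- enum {: 'X_{1..n < d.+1}} & mdeg (val m) == d].

Definition veronese_num (n d : nat) : nat := size (veronese_exps n d).

Lemma mem_veronese_exps n d m : (m \in veronese_exps n d) = (mdeg m == d).
Proof.
apply/mapP/idP => [[m' ] | /eqP md].
  by rewrite mem_filter => /andP[h _] ->.
have h : (mdeg m < d.+1)%N by rewrite md.
by exists (BMultinom h); rewrite // mem_filter /= md eqxx mem_enum.
Qed.

Lemma veronese_exps_uniq n d : uniq (veronese_exps n d).
Proof.
rewrite map_inj_uniq; last exact: val_inj.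
by rewrite filter_uniq ?enum_uniq.
Qed.

Lemma veronese_numE n d : (0 < n)%N -> veronese_num n d = 'C(d + n - 1, d).
Proof.
case: n => // n _; rewrite addnS subn1 /= -size_basis; apply: perm_size.
apply: uniq_perm (veronese_exps_uniq _ _) (uniq_basis _ _) _ => m.
by rewrite mem_veronese_exps basis_cover.
Qed.

Section Veronese.
Context (K : fieldType) (n d k : nat).
Local Notation R := {mpoly K[veronese_num n d]}.

(* The ring morphism R -> S mapping y_i to x^{a_i}. *)
Definition veronese_map (p : R) : {mpoly K[n]} :=
  p \mPo [tuple 'X_[tnth (in_tuple (veronese_exps n d)) i] |
          i < veronese_num n d].

(* The polynomials all of whose monomials have a degree of the form k + i d
   with i >= 0. *)
Definition veronese_pred : {pred {mpoly K[n]}} :=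
  fun f => all (fun m => (k <= mdeg m)%N && (d %| mdeg m - k)%N) (msupp f).

Lemma veronese_predP (f : {mpoly K[n]}) :
  reflect (forall m, m \in msupp f -> exists i, mdeg m = (k + i * d)%N)
          (f \in veronese_pred).
Proof.
apply: (iffP allP) => h m /h.
  by case/andP => km /dvdnP[i e]; exists i; rewrite -e subnKC.
by case=> i ->; rewrite leq_addr addKn dvdn_mull.
Qed.

Lemma veronese_zmod_closed : zmod_closed veronese_pred.
Proof.
split=> [|f g /allP hf /allP hg]; first by apply/allP => m; rewrite msupp0.
apply/allP => m /msuppB_le; rewrite mem_cat => /orP[]; [exact: hf | exact: hg].
Qed.
HB.instance Definition _ :=
  GRing.isZmodClosed.Build {mpoly K[n]} veronese_pred veronese_zmod_closed.

Record veronese_mod := VeroneseMod {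
  veronese_val :> {mpoly K[n]};
  veronese_valP : veronese_val \in veronese_pred
}.
HB.instance Definition _ := [isSub for veronese_val].
HB.instance Definition _ := [Choice of veronese_mod by <:].
HB.instance Definition _ := [SubChoice_isSubZmodule of veronese_mod by <:].

Lemma veronese_map_homog e (p : R) :
  p \is e.-homog -> veronese_map p \is (d * e).-homog.
Proof.
move=> /dhomogP hp; rewrite /veronese_map comp_mpolyEX.
rewrite big_seq rpred_sum // => m /hp em; rewrite dhomogZ // comp_mpolyX.
rewrite -em /= mdegE big_distrr /=.
pose P (q : {mpoly K[n]}) c := q \is c.-homog.
apply: (big_ind2 P) => [|q1 c1 q2 c2 h1 h2|i _]; first exact: dhomog1.
  exact: dhomogM.
apply: dhomogMn; rewrite tnth_mktuple dhomogX.
by rewrite /= -mem_veronese_exps mem_tnth.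
Qed.

Lemma veronese_map_deg (p : R) m : m \in msupp (veronese_map p) -> (d %| mdeg m)%N.
Proof.
rewrite /veronese_map comp_mpolyEX => /msupp_sum_le/flattenP[/= s] /mapP[q].
rewrite mem_filter => /andP[_ qp] -> ms.
have := @veronese_map_homog (mdeg q) 'X_[q].
rewrite dhomogX eqxx => /(_ isT)/dhomogP/(_ m).
by rewrite /veronese_map => -> //; [exact: dvdn_mulr | exact: msuppZ_le ms].
Qed.

Lemma veronese_scale_subproof (p : R) (f : veronese_mod) :
  veronese_map p * (f : {mpoly K[n]}) \in veronese_pred.
Proof.
apply/veronese_predP => m /msuppM_le/allpairsP[[m1 m2] /=].
case=> /veronese_map_deg/dvdnP[i1 e1] /(veronese_predP _ (veronese_valP f))[i2 e2] ->.
by exists (i1 + i2)%N; rewrite mdegD e1 e2 mulnDl addnCA.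
Qed.

Definition veronese_scale (p : R) (f : veronese_mod) : veronese_mod :=
  VeroneseMod (veronese_scale_subproof p f).

Lemma veronese_scaleA p q f :
  veronese_scale p (veronese_scale q f) = veronese_scale (p * q) f.
Proof. by apply: val_inj; rewrite /= /veronese_map rmorphM mulrA. Qed.

Lemma veronese_scale1 : left_id 1 veronese_scale.
Proof. by move=> f; apply: val_inj; rewrite /= /veronese_map rmorph1 mul1r. Qed.

Lemma veronese_scaleDr : right_distributive veronese_scale +%R.
Proof. by move=> p f g; apply: val_inj; rewrite /= mulrDr. Qed.

Lemma veronese_scaleDl f : {morph veronese_scale^~ f : p q / p + q}.
Proof. by move=> p q; apply: val_inj; rewrite /= /veronese_map rmorphD mulrDl. Qed.

HB.instance Definition _ := GRing.Zmodule_isLmodule.Build R veronese_mod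
  veronese_scaleA veronese_scale1 veronese_scaleDr veronese_scaleDl.

Definition veronese_homog (j : int) : {pred veronese_mod} :=
  fun f => all (fun m => (mdeg m)%:Z == j) (msupp (f : {mpoly K[n]})).

Lemma veronese_homogP j (f : veronese_mod) :
  reflect (forall m, (mdeg m)%:Z != j -> (f : {mpoly K[n]})@_m = 0)
          (f \in veronese_homog j).
Proof.
apply: (iffP allP) => h m.
  by move=> nj; apply/eqP; rewrite mcoeff_eq0; apply: contra nj => /h.
by rewrite mcoeff_msupp; apply: contraR => /h ->.
Qed.

Lemma veronese_homogB j f g :
  f \in veronese_homog j -> g \in veronese_homog j -> f - g \in veronese_homog j.
Proof.
move=> /veronese_homogP hf /veronese_homogP hg; apply/veronese_homogP => m nj.
by rewrite mcoeffB hf // hg // subr0.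
Qed.

Lemma veronese_homogZ e j (p : R) f :
  p \is e.-homog -> f \in veronese_homog j ->
  p *: f \in veronese_homog (j + (d * e)%:Z).
Proof.
move=> /veronese_map_homog/dhomogP hp /allP hf.
apply/allP => m /msuppM_le/allpairsP[[m1 m2] /= [/hp h1 /hf/eqP h2 ->]].
by rewrite mdegD h1 PoszD addrC h2.
Qed.

Lemma veronese_val_sum (I : Type) (r : seq I) (f : I -> veronese_mod) :
  veronese_val (\sum_(i <- r) f i) = \sum_(i <- r) veronese_val (f i).
Proof. exact: (big_morph veronese_val (fun _ _ => erefl) erefl). Qed.

Lemma veronese_decomp (f : veronese_mod) :
  exists (s : seq int) (g : int -> veronese_mod),
    [/\ uniq s, forall j, g j \in veronese_homog j & f = \sum_(j <- s) g j].
Proof.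
have hP e : pihomog mdeg e f \in veronese_pred.
  apply/veronese_predP => m; rewrite pihomogE.
  move=> /msupp_sum_le/flattenP[/= s] /mapP[q].
  rewrite mem_filter => /andP[_ qf] -> /msuppZ_le.
  rewrite msuppX mem_seq1 => /eqP ->.
  exact: (veronese_predP _ (veronese_valP f)).
pose g (j : int) : veronese_mod :=
  if j is Posz e then VeroneseMod (hP e) else 0.
exists [seq (Posz e) | e <- iota 0 (msize f)], g; split.
- by rewrite map_inj_uniq ?iota_uniq // => a b [].
- move=> [e|e]; last by apply/veronese_homogP => m _; rewrite mcoeff0.
  apply/veronese_homogP => m nj.
  by apply: (dhomog_nemf_coeff (pihomogP mdeg e f)).
- apply: val_inj; rewrite /= veronese_val_sum big_map.
  rewrite {1}(@pihomog_partitionE _ _ mdeg (msize f) f) //.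
  by rewrite -(big_mkord xpredT (fun e => pihomog mdeg e f)) /index_iota subn0.
Qed.

Lemma veronese_direct (s : seq int) (f : int -> veronese_mod) :
  uniq s -> (forall j, f j \in veronese_homog j) -> \sum_(j <- s) f j = 0 ->
  {in s, forall j, f j = 0}.
Proof.
move=> us hf s0 j js; apply: val_inj; apply/mpolyP => m; rewrite mcoeff0.
have [ej | nj] := eqVneq (mdeg m)%:Z j; last first.
  by move/veronese_homogP: (hf j) => ->.
have /(congr1 (fun v : veronese_mod => (v : {mpoly K[n]})@_m)) := s0.
rewrite mcoeff0 veronese_val_sum raddf_sum /= (bigD1_seq j) //= big1 ?addr0 //.
move=> i ij; move/veronese_homogP: (hf i) => -> //.
by rewrite ej eq_sym.
Qed.

(* S_{n,d,k}, where elements of S_{k+id} have degree k + i d. *)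
Definition veronese : gradedModule K (veronese_num n d) d :=
  GradedModule veronese_homogB veronese_homogZ veronese_decomp veronese_direct.

End Veronese.

(* Main.v *)
Require Import Defs.
From HB Require Import structures.
From mathcomp Require Import all_boot all_order all_algebra.
From mathcomp.multinomials Require Import freeg mpoly.
From mathcomp Require Import zify.

(* Tor_p(M, K)_j is compared with the Koszul homology of M in exterior degree p
   by dimension shifting along the given resolution, the Koszul complex of all
   the variables being acyclic on free modules.  The Koszul terms involve the
   degree k + i d part of M in exterior degree p, which is zero for i < 0.

   For i >= n, take first the n variables acting as x_1^d, ..., x_n^d.  They
   form a regular sequence up to the truncation of M, which does not matter in
   these degrees, and every monomial of degree at least n d is divisible by some
   x_l^d; so their Koszul homology vanishes.  Each further variable preserves
   the vanishing, by the long exact sequence of the mapping cone, as the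
   difference i between the degree and the exterior degree is unchanged. *)

Import Order.TTheory GRing.Theory Num.Theory.
Local Open Scope ring_scope.

Set Implicit Arguments.
Unset Strict Implicit.
Unset Printing Implicit Defensive.

(** * Koszul complexes over a commutative ring *)

Section Koszul.
Context (R : comNzRingType) (I : Type) (X : I -> R).
Implicit Types (i : I) (s : seq I) (M : lmodType R).

Section Complex.
Context (M : lmodType R).

(* The Koszul complex of the sequence X s, as an iterated mapping cone: the pair
   (a, b) stands for a + e_i /\ b.  All exterior degrees are taken together. *)
Fixpoint kos s : lmodType R :=
  if s is _ :: s' then [the lmodType R of (kos s' * kos s')%type] else M.

Fixpoint kdiff s : kos s -> kos s :=
  match s return kos s -> kos s with
  | [::] => fun _ => 0
  | i :: s' => fun z : kos s' * kos s' => (kdiff z.1 + X i *: z.2, - kdiff z.2)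
  end.

Fixpoint kin s (x : M) : kos s :=
  if s is i :: s' then (kin s' x, 0 : kos s') else x.
End Complex.

Fixpoint kmap M M' (f : M -> M') s : kos M s -> kos M' s :=
  match s return kos M s -> kos M' s with
  | [::] => f
  | i :: s' => fun z : kos M s' * kos M s' => (kmap f z.1, kmap f z.2)
  end.

Lemma kdiff_linear M s : linear (@kdiff M s).
Proof.
elim: s => [|i s IH] a x y /=; first by rewrite scaler0 addr0.
apply: injective_projections; rewrite /= IH.
  by rewrite !scalerDr !scalerA [_ * a]mulrC addrACA.
by rewrite opprD scalerN.
Qed.
HB.instance Definition _ M s :=
  GRing.isLinear.Build R (kos M s) (kos M s) _ (@kdiff M s) (@kdiff_linear M s).

Lemma kdiffK M s (z : kos M s) : kdiff (kdiff z) = 0.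
Proof.
elim: s z => [|i s IH] //= z; apply: injective_projections => /=.
  by rewrite linearD linearZ /= IH add0r scalerN subrr.
by rewrite linearN /= IH !oppr0.
Qed.

Lemma kmap_linear M M' (f : {linear M -> M'}) s : linear (@kmap M M' f s).
Proof.
elim: s => [|i s IH] a x y /=; first by rewrite linearP.
by apply: injective_projections; rewrite /= IH.
Qed.
HB.instance Definition _ M M' (f : {linear M -> M'}) s :=
  GRing.isLinear.Build R (kos M s) (kos M' s) _ (@kmap M M' f s)
    (@kmap_linear M M' f s).

Lemma kmap_diff M M' (f : {linear M -> M'}) s (z : kos M s) :
  kmap f (kdiff z) = kdiff (kmap f z).
Proof.
elim: s z => [|i s IH] z /=; first exact: linear0.
by rewrite linearD linearZ linearN /= !IH.
Qed.

Lemma kmap_comp0 M M' M'' (f : M -> M') (g : M' -> M'') s (z : kos M s) :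
  (forall x, g (f x) = 0) -> kmap g (kmap f z) = 0.
Proof. by move=> h; elim: s z => [|i s IH] z /=; rewrite ?h ?IH. Qed.

Lemma kmap0 M M' s (z : kos M s) : kmap (fun=> 0 : M') z = 0.
Proof. by elim: s z => [|i s IH] z //=; rewrite !IH. Qed.

Lemma kmap_0 M M' (f : M -> M') s : f 0 = 0 -> kmap f (0 : kos M s) = 0.
Proof. by move=> f0; elim: s => [|i s IH] //=; rewrite IH. Qed.

Lemma kin_is_zmod_morphism M s : zmod_morphism (@kin M s).
Proof. elim: s => [|i s IH] x y //=.
by apply: injective_projections; rewrite /= ?IH ?subr0. Qed.
HB.instance Definition _ M s :=
  GRing.isZmodMorphism.Build M (kos M s) (@kin M s) (@kin_is_zmod_morphism M s).

Lemma kin_inj M s : injective (@kin M s).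
Proof. by elim: s => [|i s IH] x y //= [] /IH. Qed.

Lemma kmap_kin M M' (f : M -> M') s x : f 0 = 0 ->
  kmap f (kin s x) = kin s (f x).
Proof. by move=> f0; elim: s => [|i s IH] //=; rewrite IH kmap_0. Qed.

Lemma kin_scale M s a x : kin s (a *: x : M) = a *: kin s x.
Proof.
elim: s => [|i s IH] //=.
by apply: injective_projections; rewrite /= ?IH ?scaler0.
Qed.

End Koszul.

(** * Graded Koszul homology, regular sequences and dimension shifting *)

Section Graded.
Context (K : fieldType) (N w : nat).
Local Notation R := {mpoly K[N]}.
Implicit Types (i : 'I_N) (s : seq 'I_N) (M : gradedModule K N w).
Local Notation kdiff := (@kdiff _ 'I_N (fun i => 'X_i) _ _).

(* Elements of exterior degree q with coefficients in M_j; thus j is the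
   internal degree minus q w. *)
Fixpoint khom M s q j : kos M s -> Prop :=
  match s return kos M s -> Prop with
  | [::] => fun z => if q is 0 then z \in gm_homog M j else z = 0
  | i :: s' => fun z : kos M s' * kos M s' => khom q j z.1 /\
      if q is q'.+1 then khom q' j z.2 else z.2 = 0
  end.

Lemma gm_homogD M j x y :
  x \in gm_homog M j -> y \in gm_homog M j -> x + y \in gm_homog M j.
Proof.
move=> hx hy; rewrite -[y]opprK gm_homogB // -sub0r gm_homogB //.
exact: gm_homog0.
Qed.

Lemma gm_homogXZ M i j x :
  x \in gm_homog M j -> 'X_i *: x \in gm_homog M (j + w%:Z).
Proof.
move=> hx; have := @gm_homogZ _ _ _ M 1 j 'X_i x.
by rewrite muln1; apply=> //; rewrite dhomogX /= mdeg1.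
Qed.

Lemma khom0 M s q j : @khom M s q j 0.
Proof.
elim: s q => [|i s IH] [|q] //=; try by split.
exact: gm_homog0.
Qed.

Lemma khomB M s q j (x y : kos M s) :
  khom q j x -> khom q j y -> khom q j (x - y).
Proof.
elim: s q x y => [|i s IH] [|q] x y /=.
- exact: gm_homogB.
- by move=> -> ->; rewrite subr0.
- by move=> [hx ex] [hy ey]; rewrite ex ey subr0; split=> //; exact: IH.
- by move=> [hx ex] [hy ey]; split; exact: IH.
Qed.

Lemma khomN M s q j (x : kos M s) : khom q j x -> khom q j (- x).
Proof. by rewrite -sub0r; apply: khomB; exact: khom0. Qed.

Lemma khomD M s q j (x y : kos M s) :
  khom q j x -> khom q j y -> khom q j (x + y).
Proof.
by move=> hx hy; rewrite -[y]opprK; apply: khomB => //; exact: khomN.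
Qed.

Lemma khomXZ M s q j i (x : kos M s) :
  khom q j x -> khom q (j + w%:Z) ('X_i *: x).
Proof.
elim: s q x => [|i' s IH] [|q] x /=.
- exact: gm_homogXZ.
- by move=> ->; rewrite scaler0.
- by case=> /IH h1 ->; rewrite scaler0.
- by case=> /IH h1 /IH h2.
Qed.

Lemma kdiff_khom0 M s j (z : kos M s) : khom 0 j z -> kdiff z = 0.
Proof.
elim: s z => [|i s IH] z //= [h ->].
by rewrite scaler0 addr0 IH // linear0 oppr0.
Qed.

Lemma khom_diff M s q j (z : kos M s) :
  khom q.+1 j z -> khom q (j + w%:Z) (kdiff z).
Proof.
elim: s q z => [|i s IH] q z /=.
  by move=> _; case: q => //=; exact: gm_homog0.
case=> h1 h2; split; first by apply: khomD; [exact: IH | exact: khomXZ].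
case: q h1 h2 => [|q] h1 h2; last by apply: khomN; exact: IH.
by rewrite (kdiff_khom0 h2) oppr0.
Qed.

Lemma khom_map M M' (f : M -> M') s q j (z : kos M s) :
  graded_hom f -> f 0 = 0 ->
  khom q j z -> khom q j (kmap f z).
Proof.
move=> hf f0; elim: s q z => [|i s IH] [|q] z /=.
- exact: hf.
- by move=> ->.
- by case=> /IH h ->; rewrite kmap_0.
- by case=> /IH h1 /IH h2.
Qed.

(** [kmap] acts on each coefficient separately and all coefficients of [z] have degree [j], so
    exactness at [M] in that single degree suffices. *)
Lemma khom_lift M'' M M' (g : M'' -> M) (f : M -> M') s q j (z : kos M s) :
  g 0 = 0 ->
  (forall x, x \in gm_homog M j -> f x = 0 ->
    exists2 y, y \in gm_homog M'' j & x = g y) ->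
  khom q j z -> kmap f z = 0 -> exists2 y, khom q j y & z = kmap g y.
Proof.
move=> g0 h; elim: s q z => [|i s IH] q z /=.
  by case: q => [|q]; [exact: h | move=> -> _; exists 0].
case: z => a b /= [ha hb] [fa fb].
have [a' ha' ->] := IH _ _ ha fa.
case: q hb {ha ha'} (ha') => [-> | q hb] ha'.
  by exists (a', 0); rewrite //= kmap_0.
by have [b' hb' ->] := IH _ _ hb fb; exists (a', b').
Qed.

Lemma khom_trivial M s q j (z : kos M s) :
  (forall x, x \in gm_homog M j -> x = 0) -> khom q j z -> z = 0.
Proof.
move=> h; elim: s q z => [|i s IH] q z /=; first by case: q => // /h.
by case: z => a b /= [/IH ->]; case: q => [|q]; [move=> -> | move=> /IH ->].
Qed.

(** The differential multiplies coefficients by variables, hence [j + w] for the cycle and [j] for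
    the element bounding it. *)
Definition kexact M s q j := forall z : kos M s,
  khom q (j + w%:Z) z -> kdiff z = 0 -> exists2 y, khom q.+1 j y & z = kdiff y.

Lemma kexact_cons0 M i s j : kexact M s 0 j -> kexact M (i :: s) 0 j.
Proof.
move=> h [a b] /= [ha ->] [da _].
have [|a' ha' ->] := h _ ha; first exact: kdiff_khom0 ha.
exists (a', 0); first by split=> //; exact: khom0.
by rewrite /= scaler0 addr0 linear0 oppr0.
Qed.

(** Once [b] is the boundary of [b'], the element [a + 'X_i *: b'] is a cycle over [s], hence a
    boundary. The hypothesis on [b] is met either by exactness over [s] or by regularity of y_i. *)
Lemma kexact_consS M i s q j (a b : kos M s) :
  kexact M s q.+1 j ->
  khom q.+1 (j + w%:Z) a -> kdiff a + 'X_i *: b = 0 ->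
  (exists2 b', khom q.+1 j b' & b = kdiff b') ->
  exists2 y : kos M (i :: s), khom q.+2 j y & (a, b) = kdiff y.
Proof.
move=> h ha da [b' hb' eb].
have [||a' ha' ea] := h (a + 'X_i *: b').
- by apply: khomD => //; exact: khomXZ.
- by rewrite linearD linearZ /= -eb.
exists (a', - b'); first by split=> //; exact: khomN.
by rewrite /= -ea scalerN addrK linearN /= -eb opprK.
Qed.

Lemma kexact_cat M s s' j :
  (forall q, kexact M s q j) -> forall q, kexact M (s' ++ s) q j.
Proof.
move=> h; elim: s' => [|i s' IH] //= [|q]; first exact: kexact_cons0.
move=> [a b] /= [ha hb] [da db]; apply: kexact_consS => //.
apply: (IH q b hb).
by apply/eqP; rewrite -oppr_eq0 db.
Qed.

(* Degree j + w part of the submodule generated by the y_i M, i in s. *)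
Fixpoint ksub M s j (x : M) : Prop :=
  if s is i :: s' then
    exists2 y, y \in gm_homog M j & ksub s' j (x - 'X_i *: y)
  else x = 0.

Lemma khom0P M s j (z : kos M s) :
  khom 0 j z <-> exists2 x, x \in gm_homog M j & z = kin s x.
Proof.
split; last first.
  by case=> x hx ->; elim: s {z} => //.
elim: s z => [|i s IH] z /=; first by exists z.
by case: z => a b /= [/IH[x hx ->] ->]; exists x.
Qed.

(** An element of exterior degree 1 is a family of elements of [M] indexed by [s]; its boundary is
    their combination with the variables as coefficients. *)
Lemma ksubP M s j (x : M) :
  ksub s j x <-> exists2 z, khom 1 j z & kin s x = kdiff z.
Proof.
elim: s x => [|i s IH] x /=.
  by split=> [-> | [z _ ->]] //; exists 0.
split=> [[y hy /IH[z hz ez]] | [[a b] /= [ha /khom0P[y hy ->]] [e _]]].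
  exists (z, kin s y).
    by split=> //; apply/khom0P; exists y.
  rewrite /= -ez -kin_scale -raddfD subrK (@kdiff_khom0 _ _ j) ?oppr0 //.
  by apply/khom0P; exists y.
exists y => //; apply/IH; exists a => //.
by rewrite raddfB /= e kin_scale addrK.
Qed.

Lemma ksub0 M s j : ksub s j (0 : M).
Proof.
elim: s => //= i s IH; exists 0; first exact: gm_homog0.
by rewrite scaler0 subr0.
Qed.

Lemma ksubD M s j (x y : M) : ksub s j x -> ksub s j y -> ksub s j (x + y).
Proof.
elim: s x y => [|i s IH] x y /=; first by move=> -> ->; rewrite addr0.
move=> [x' hx ex] [y' hy ey]; exists (x' + y'); first exact: gm_homogD.
by rewrite scalerDr opprD addrACA; exact: IH.
Qed.

Lemma ksubXZ M s i j (y : M) :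
  i \in s -> y \in gm_homog M j -> ksub s j ('X_i *: y).
Proof.
elim: s => //= i' s IH; rewrite inE => /predU1P[<- | /IH h] hy.
  by exists y => //; rewrite subrr; exact: ksub0.
by exists 0; [exact: gm_homog0 | rewrite scaler0 subr0; exact: h].
Qed.

Lemma kexact0 M s j :
  (forall x, x \in gm_homog M (j + w%:Z) -> ksub s j x) -> kexact M s 0 j.
Proof. by move=> h z /khom0P[x /h/ksubP[y hy ->] ->] _; exists y. Qed.

(* The hypothesis says that y_i is a nonzerodivisor, in degree j + w,
   modulo the part of s that follows it. *)
Lemma kexact_regular M s q j :
  (forall s1 i s2 x, s = s1 ++ i :: s2 -> x \in gm_homog M (j + w%:Z) ->
    ksub s2 (j + w%:Z) ('X_i *: x) -> ksub s2 j x) ->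
  kexact M s q.+1 j.
Proof.
elim: s q => [|i s IH] q hs /=; first by move=> z /= -> _; exists 0.
have {}IH q' : kexact M s q'.+1 j.
  by apply: IH => s1 i' s2 x es; apply: (hs (i :: s1)); rewrite es.
move=> [a b] /= [ha hb] [da db]; apply: kexact_consS => //.
have {}db : kdiff b = 0 by apply/eqP; rewrite -oppr_eq0 db.
(* The induction hypothesis covers [b] of positive exterior degree. In exterior degree 0 the cycle
   condition says that y_i [b] is the boundary of [- a], and regularity makes [b] a boundary. *)
case: q ha hb => [|q] ha hb; last exact: IH.
have /khom0P[x hx ebx] := hb.
rewrite ebx; apply/ksubP/(hs [::] i s) => //; apply/ksubP; exists (- a).
  exact: khomN.
rewrite kin_scale -ebx linearN; apply/eqP.
by rewrite -addr_eq0 addrC da.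
Qed.

(* Vanishing of the same Koszul homology for the submodule im f of M', whose
   elements are represented by preimages in M. *)
Definition kexact_im M M' (f : M -> M') s q j := forall z : kos M s,
  khom q (j + w%:Z) z -> kdiff (kmap f z) = 0 ->
  exists2 y, khom q.+1 j y & kmap f z = kmap f (kdiff y).

Definition gexact M'' M M' (g : M'' -> M) (f : M -> M') :=
  (forall y, f (g y) = 0) /\
  (forall j x, x \in gm_homog M j -> f x = 0 ->
    exists2 y, y \in gm_homog M'' j & x = g y).

Lemma kexact_surj M M' (f : {linear M -> M'}) s q j :
  graded_hom f -> (forall j x, x \in gm_homog M' j ->
    exists2 y, y \in gm_homog M j & x = f y) ->
  kexact M' s q j -> kexact_im f s q j.
Proof.
move=> hf fs ex z hz dz.
have [|y hy ey] := ex _ _ dz; first by apply: khom_map => //; exact: linear0.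
(* The zero map on [M'] turns surjectivity of [f] into the exactness that [khom_lift] asks for. *)
have [||y' hy' ey'] :=
  @khom_lift M M' M' f (fun=> 0) s q.+1 j y _ _ hy (kmap0 _ _).
- exact: linear0.
- by move=> x /fs.
by exists y' => //; rewrite ey ey' kmap_diff.
Qed.

(* Dimension shifting along 0 -> im g -> M -> im f -> 0. *)
Lemma kexact_shift M'' M M' (g : {linear M'' -> M}) (f : {linear M -> M'}) s q j
    (z : kos M'' s) (y : kos M s) :
  gexact g f -> kexact_im f s q.+1 j -> khom q.+1 (j + w%:Z) y ->
  kmap g z = kdiff y ->
  exists2 u, khom q.+1 (j + w%:Z) u & kmap g z = kmap g (kdiff u).
Proof.
move=> [gf fg] ef hy e; have [|v hv ev] := ef y hy.
  by rewrite -kmap_diff -e kmap_comp0.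
(* [y - kdiff v] is killed by [f], so it comes from some [u]; the term [kdiff v] disappears in the
   boundary. *)
have [||||u hu eu] := @khom_lift M'' M M' g f s q.+1 (j + w%:Z) (y - kdiff v).
- exact: linear0.
- exact: fg.
- by apply: khomB => //; exact: khom_diff.
- by rewrite linearB /= ev subrr.
exists u => //; rewrite e kmap_diff -eu linearB /= kdiffK subr0 //.
Qed.

(** As [M] is acyclic here, the connecting map embeds the homology of im g in exterior degree
    [q + 1] into that of im f in exterior degree [q + 2]. *)
Lemma kexact_im_shift M'' M M' (g : {linear M'' -> M}) (f : {linear M -> M'})
    s q j :
  graded_hom g -> gexact g f -> kexact M s q.+1 (j + w%:Z) ->
  kexact_im f s q.+2 j -> kexact_im g s q.+1 (j + w%:Z).
Proof.
move=> hg gf acyc ef z hz dz.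
have [|y hy ey] := acyc _ _ dz; first by apply: khom_map => //; exact: linear0.
exact: kexact_shift gf ef hy ey.
Qed.

End Graded.

(** * Regularity tested on monomials *)

Section Monomials.
Context (K : fieldType) (N w : nat) (M : gradedModule K N w) (T : Type).
(* In the applications t runs over the monomials of M, co t is the coefficient
   of t, shift i t = y_i t, and divides i t says that t lies in y_i M. *)
Context (co : T -> M -> K) (divides : 'I_N -> T -> bool).
Context (shift : 'I_N -> T -> T).
Hypothesis coB : forall t, zmod_morphism (co t).
Hypothesis co_divides : forall i t x, co t ('X_i *: x) != 0 -> divides i t.
Hypothesis co_shift : forall i t x, co (shift i t) ('X_i *: x) = co t x.

Lemma ksub_divides s j x t :
  ksub s j x -> co t x != 0 -> has (divides^~ t) s.
Proof.
elim: s x => [|i s IH] x /=.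
  by move=> ->; rewrite -(subrr 0) coB subrr eqxx.
move=> [y _ hs] hx; have [// | nd /=] := boolP (divides i t).
apply: (IH _ hs); rewrite coB.
have /eqP -> : co t ('X_i *: y) == 0 by apply: contraNT nd => /co_divides.
by rewrite subr0.
Qed.

(** If [t] occurs in [x], then y_i t occurs in y_i x, so some variable of [s] divides y_i t, hence
    also [t] by the coprimality assumption. *)
Lemma ksub_regular s i j x :
  (forall i' t, i' \in s -> divides i' (shift i t) -> divides i' t) ->
  (forall x, x \in gm_homog M (j + w%:Z) ->
    (forall t, co t x != 0 -> has (divides^~ t) s) -> ksub s j x) ->
  x \in gm_homog M (j + w%:Z) -> ksub s (j + w%:Z) ('X_i *: x) -> ksub s j x.
Proof.
move=> hs hsub hx hX; apply: hsub => // t.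
rewrite -(co_shift i) => /(ksub_divides hX).
by case/hasP => i' si' /(hs _ _ si') di'; apply/hasP; exists i'.
Qed.

End Monomials.

(** * Sums and homogeneous preimages in graded modules *)

Section GradedModules.
Context (K : fieldType) (N w : nat).
Implicit Types (M : gradedModule K N w).

Lemma ksub_sum M s j (I : eqType) (r : seq I) (f : I -> M) :
  (forall i, i \in r -> ksub s j (f i)) -> ksub s j (\sum_(i <- r) f i).
Proof.
move=> h; rewrite big_seq; apply: big_ind => //; first exact: ksub0.
by move=> x y; exact: ksubD.
Qed.

Lemma graded_hom_lift M M' (f : {linear M -> M'}) j v :
  graded_hom f -> f v \in gm_homog M' j ->
  exists2 v', v' \in gm_homog M j & f v = f v'.
Proof.
move=> hf hx; have [s [g [us hg ev]]] := gm_decomp v.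
(* Values of [g] outside [s] are not components of [v]; they are replaced by 0. *)
pose g' j' := if j' \in s then g j' else 0.
(* This family is homogeneous with sum 0, so its entry in degree [j] vanishes. *)
pose h j' := f (g' j') - (if j' == j then f v else 0).
pose s' := undup (j :: s).
have js : j \in s' by rewrite mem_undup mem_head.
have us' : uniq s' by exact: undup_uniq.
have hg' j' : g' j' \in gm_homog M j'.
  by rewrite /g'; case: ifP => _ //; exact: gm_homog0.
exists (g' j) => //; apply/esym/eqP; rewrite -subr_eq0; apply/eqP.
have := @gm_direct _ _ _ M' s' h us' _ _ j js; rewrite /h eqxx; apply.
  move=> j'; apply: gm_homogB; first exact: hf.
  by case: eqP => [-> // | _]; exact: gm_homog0.
have -> : \sum_(j' <- s') (f (g' j') - (if j' == j then f v else 0)) =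
    f (\sum_(j' <- s') g' j') - f v.
  rewrite sumrB (raddf_sum f); congr (_ - _).
  by rewrite -big_mkcond -big_filter filter_pred1_uniq // big_seq1.
rewrite (_ : \sum_(j' <- s') g' j' = v) ?subrr //.
rewrite [RHS]ev [RHS](eq_big_seq g') => [|j' sj']; last by rewrite /g' sj'.
rewrite (bigID (mem s)) /= [X in _ + X]big1 ?addr0 => [|j' /negPf sj'].
  rewrite -big_filter; apply: perm_big; apply: uniq_perm => //.
    exact: filter_uniq.
  move=> j'; rewrite mem_filter mem_undup inE.
  by case: (_ \in s); rewrite ?orbT.
by rewrite /g' sj'.
Qed.

End GradedModules.

(** * Koszul acyclicity of graded free modules *)

Section Free.
Context (K : fieldType) (N w : nat) (B : choiceType) (deg : B -> int).
Local Notation F := (graded_free K N w deg).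
Implicit Types (s : seq 'I_N) (x : F).

Lemma freegZU (A : nzRingType) (c : A) (b : B) :
  << c *g b >> = c *: << b >> :> {freeg B / A}.
Proof.
by apply/eqP/freeg_eqP => b'; rewrite coeffZ !coeffU mul1r.
Qed.

Lemma free_monomials x : x = \sum_(b <- dom x) \sum_(m <- msupp (coeff b x))
  ((coeff b x)@_m *: 'X_[m]) *: (<< b >> : F).
Proof.
rewrite -[LHS](@freeg_sumE _ _ x); apply: eq_bigr => b _.
by rewrite -scaler_suml -mpolyE freegZU.
Qed.

Lemma free_homogU j c (b : B) (m : 'X_{1..N}) :
  deg b + (w * mdeg m)%:Z = j ->
  (c *: 'X_[m]) *: (<< b >> : F) \in gm_homog F j.
Proof.
move=> e; apply/free_homogP => b' m' nj; rewrite coeffZ coeffU mul1r.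
have [eb | _] := eqVneq b b'; last by rewrite mulr0 mcoeff0.
rewrite mulr1 mcoeffZ mcoeffX.
have [em | _] := eqVneq m m'; last by rewrite mulr0.
by rewrite -eb -em e eqxx in nj.
Qed.

Lemma free_ksub s j x : x \in gm_homog F (j + w%:Z) ->
  (forall b m, (coeff b x)@_m != 0 -> exists2 i, i \in s & (0 < m i)%N) ->
  ksub s j x.
Proof.
move=> /free_homogP hx hs; rewrite (free_monomials x).
apply: ksub_sum => b _; apply: ksub_sum => m; rewrite mcoeff_msupp => hm.
have [i si mi] := hs _ _ hm.
have em : (m = U_(i) + (m - U_(i)))%MM.
  by rewrite addmC submK // lep1mP -lt0n.
have ej : deg b + (w * mdeg m)%:Z = j + w%:Z.
  by apply/eqP; move: hm; apply: contraR => /hx ->.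
have -> : ((coeff b x)@_m *: 'X_[m]) *: (<< b >> : F) =
    'X_i *: (((coeff b x)@_m *: 'X_[m - U_(i)]) *: (<< b >> : F)).
  by rewrite scalerA -scalerAr -mpolyXD -em.
apply: ksubXZ => //; apply: free_homogU.
move: ej; rewrite em mdegD mdeg1 -em mulnDr muln1 PoszD.
by rewrite addrCA [RHS]addrC => /addrI.
Qed.

(** Distinct variables form a regular sequence: multiplying a monomial by one of them does not
    change its divisibility by another. *)
Lemma free_kexact s q j : uniq s -> kexact F s q.+1 j.
Proof.
move=> us; apply: kexact_regular => s1 i s2 x es.
apply: (@ksub_regular _ _ _ F (B * 'X_{1..N})
  (fun t x => (coeff t.1 x)@_(t.2)) (fun i t => (0 < t.2 i)%N)
  (fun i t => (t.1, (U_(i) + t.2)%MM))).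
- by move=> t y z; rewrite coeffB mcoeffB.
- move=> i' [b m] y /=; rewrite coeffZ mulrC -mcoeff_msupp.
  rewrite (perm_mem (msuppMX _ _)) => /mapP[m' _ ->].
  by rewrite mnmDE mnm1E eqxx.
- by move=> i' [b m] y /=; rewrite coeffZ mulrC mcoeffMX.
- move=> i' [b m] s2i' /=; rewrite mnmDE mnm1E.
  case: eqVneq => // ei; move: us.
  by rewrite es cat_uniq /= ei s2i' !andbF.
- move=> y hy hs; apply: free_ksub => // b m hm.
  by have /hasP[i' ? ?] := hs (b, m) hm; exists i'.
Qed.

End Free.

(** * Koszul homology of the Veronese module *)

Section VeroneseKoszul.
Context (K : fieldType) (n d k : nat).
Hypothesis hd : (0 < d)%N.
Local Notation V := (veronese K n d k).
Local Notation N := (veronese_num n d).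
Local Notation vexp i := (tnth (in_tuple (veronese_exps n d)) i).
Implicit Types (s : seq 'I_N) (x : V) (l : 'I_n).

Lemma veronese_valXZ (i : 'I_N) x :
  veronese_val ('X_i *: x) = 'X_[vexp i] * veronese_val x.
Proof.
rewrite /= /veronese_map comp_mpolyXU.
by rewrite -[in LHS](tnth_nth _ _ i) tnth_mktuple.
Qed.

Lemma pure_power_subproof l : (index (U_(l) *+ d)%MM (veronese_exps n d) < N)%N.
Proof. by rewrite index_mem mem_veronese_exps mdegMn mdeg1 mul1n. Qed.

(* The index of the variable of R that acts as x_l^d. *)
Definition pure_power l : 'I_N := Ordinal (pure_power_subproof l).

Lemma vexp_pure_power l : vexp (pure_power l) = (U_(l) *+ d)%MM.
Proof.
rewrite (tnth_nth 0%MM) /= nth_index // mem_veronese_exps.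
by rewrite mdegMn mdeg1 mul1n.
Qed.

Lemma pure_power_dvd l (m : 'X_{1..n}) :
  (vexp (pure_power l) <= m)%MM = (d <= m l)%N.
Proof.
rewrite vexp_pure_power; apply/mnm_lepP/idP => [/(_ l) | h l'].
  by rewrite mulmnE mnm1E eqxx mul1n.
by rewrite mulmnE mnm1E; case: eqVneq => [<- | _]; rewrite ?mul1n.
Qed.

Lemma pure_power_inj : injective pure_power.
Proof.
move=> l l' e; have := congr1 (fun i => (vexp i) l) e.
rewrite !vexp_pure_power !mulmnE !mnm1E eqxx; case: eqVneq => // _.
by move=> e'; move: hd; rewrite -[d]mul1n e'.
Qed.

Definition pure_powers : seq 'I_N := [seq pure_power l | l <- enum 'I_n].

Lemma pure_powers_uniq : uniq pure_powers.
Proof. by rewrite (map_inj_uniq pure_power_inj) enum_uniq. Qed.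

(** A monomial of [x] divided by the monomial of some y_i has degree [k + a * d], which is at least
    [k], so the quotient stays in the module: here the truncation is harmless. *)
Lemma veronese_ksub s a x : x \in gm_homog V ((k + a * d)%:Z + d%:Z) ->
  (forall m, (veronese_val x)@_m != 0 -> has (fun i => vexp i <= m)%MM s) ->
  ksub s (k + a * d)%:Z x.
Proof.
move=> /veronese_homogP hx hs.
(* The default 0 is never met: [eE] applies to every monomial used below. *)
pose e c m : V := insubd (0 : veronese_mod K n d k) (c *: 'X_[m]).
have eE c m b : mdeg m = (k + b * d)%N -> veronese_val (e c m) = c *: 'X_[m].
  move=> em; rewrite [LHS]val_insubd; case: ifP => // /negP[].
  apply/veronese_predP => m' /msuppZ_le; rewrite msuppX mem_seq1 => /eqP ->.
  by exists b.
have deg_m m : (veronese_val x)@_m != 0 -> mdeg m = (k + a * d + d)%N.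
  move=> hm; apply/eqP; rewrite -(inj_eq (@can_inj _ _ Posz absz _)) // PoszD.
  by move: hm; apply: contraR => /hx ->.
have -> : x = \sum_(m <- msupp (veronese_val x)) e (veronese_val x)@_m m.
  apply: val_inj; rewrite /= veronese_val_sum {1}[veronese_val x]mpolyE.
  apply: eq_big_seq => m; rewrite mcoeff_msupp => /deg_m em.
  by rewrite (eE _ _ a.+1) // em mulSn [(d + _)%N]addnC addnA.
apply: ksub_sum => m; rewrite mcoeff_msupp => hm.
have /hasP[i si im] := hs _ hm.
have mi : mdeg (vexp i) = d by apply/eqP; rewrite -mem_veronese_exps mem_tnth.
have em' : mdeg (m - vexp i)%MM = (k + a * d)%N.
  by have := deg_m _ hm; rewrite -{1}(submK im) mdegD mi => /addIn.
have -> : e (veronese_val x)@_m m =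
    'X_i *: e (veronese_val x)@_m (m - vexp i)%MM.
  apply: val_inj; rewrite [RHS]veronese_valXZ (eE _ _ a) //.
  rewrite [LHS](eE _ _ a.+1); last first.
    by rewrite (deg_m _ hm) mulSn [(d + _)%N]addnC addnA.
  by rewrite -scalerAr -mpolyXD addmC submK.
apply: ksubXZ => //; apply/veronese_homogP => m' nj.
rewrite (eE _ _ a) // mcoeffZ mcoeffX.
case: eqVneq => [em | _]; last exact: mulr0.
by rewrite -em em' eqxx in nj.
Qed.

(** The x_l^d involve distinct variables, so multiplication by one of them does not affect
    divisibility by another. *)
Lemma pure_powers_kexactS q a : kexact V pure_powers q.+1 (k + a * d)%:Z.
Proof.
apply: kexact_regular => s1 i s2 x es.
apply: (@ksub_regular _ _ _ V 'X_{1..n} (fun m x => (veronese_val x)@_m)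
  (fun i m => vexp i <= m)%MM (fun i m => vexp i + m)%MM).
- by move=> t y z; rewrite mcoeffB.
- move=> i' m y; rewrite veronese_valXZ mulrC -mcoeff_msupp.
  by rewrite (perm_mem (msuppMX _ _)) => /mapP[m' _ ->]; rewrite lem_addr.
- by move=> i' m y; rewrite veronese_valXZ mulrC mcoeffMX.
- move=> i' m s2i'.
  have sub i0 : i0 \in i :: s2 -> i0 \in pure_powers.
    by rewrite es mem_cat => ->; rewrite orbT.
  have /mapP[l _ ei] := sub i (mem_head _ _).
  have /mapP[l' _ ei'] : i' \in pure_powers.
    by apply: sub; rewrite inE s2i' orbT.
  rewrite ei ei' !pure_power_dvd mnmDE vexp_pure_power mulmnE mnm1E.
  case: eqVneq => // el; have := pure_powers_uniq.
  by rewrite es cat_uniq /= ei el -ei' s2i' !andbF.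
- by move=> y hy hs; apply: veronese_ksub.
Qed.

Lemma pure_powers_kexact q a : (0 < n)%N -> (n <= a.+1)%N ->
  kexact V pure_powers q (k + a * d)%:Z.
Proof.
move=> n0 na; case: q => [|q]; last exact: pure_powers_kexactS.
apply: kexact0 => x hx; apply: veronese_ksub => // m hm.
have em : mdeg m = (k + a * d + d)%N.
  apply/eqP; move: hm; apply: contraR => nj.
  by move/veronese_homogP: hx => -> //; rewrite -PoszD.
suff /existsP[l hl] : [exists l : 'I_n, (d <= m l)%N].
  apply/hasP; exists (pure_power l); last by rewrite pure_power_dvd.
  by apply: map_f; rewrite mem_enum.
apply: contraLR isT; rewrite negb_exists => /forallP h.
(* Pigeonhole: exponents all below [d] give degree at most [n * (d - 1)], while [n <= a + 1] forces
   degree at least [n * d]. *)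
have : (mdeg m <= n * d.-1)%N.
  rewrite mdegE -[X in (X * _)%N]card_ord -sum_nat_const; apply: leq_sum => l _.
  by have := h l; lia.
by rewrite em; nia.
Qed.

(** The pure powers come last because [kexact_cat] adds variables at the front. *)
Definition veronese_vars : seq 'I_N :=
  [seq i <- enum 'I_N | i \notin pure_powers] ++ pure_powers.

Lemma veronese_vars_uniq : uniq veronese_vars.
Proof.
rewrite cat_uniq filter_uniq ?enum_uniq ?pure_powers_uniq //= andbT.
by apply/hasPn => i /=; rewrite mem_filter => ->.
Qed.

Lemma mem_veronese_vars i : i \in veronese_vars.
Proof. by rewrite mem_cat mem_filter mem_enum andbT orNb. Qed.

Lemma veronese_kexact q (i : int) : (0 < n)%N -> ~ (0 <= i <= n%:Z - 1) ->
  kexact V veronese_vars q (k%:Z + (i - 1) * d%:Z).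
Proof.
move=> n0 hi; have [i0 | i0] := ltP i 0.
  move=> z hz _; rewrite (khom_trivial _ hz).
    by exists 0; [exact: khom0 | rewrite linear0].
  move=> x /allP hx; apply: val_inj; apply/msuppnil0.
  case e: (msupp _) => [//|m ms] /=.
  have mx : m \in msupp (veronese_val x) by rewrite e mem_head.
  have /(_ m mx)[b hb] := veronese_predP _ _ _ (veronese_valP x).
  by have /eqP := hx m mx; rewrite hb; nia.
(* Now [i >= n >= 1], so [a = i - 1] is a natural number with [n <= a + 1]. *)
have [a ei] : exists a : nat, i = a.+1%:Z by exists (`|i|.-1)%N; lia.
have -> : k%:Z + (i - 1) * d%:Z = (k + a * d)%:Z by rewrite ei; lia.
apply: kexact_cat => q'; apply: pure_powers_kexact => //; lia.
Qed.

End VeroneseKoszul.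

(** * Reduction modulo the variables *)

Section ConstPart.
Context (K : fieldType) (N : nat).
Local Notation R := {mpoly K[N]}.

Lemma coeff_map_dom (A A' : nzRingType) (g : A -> A') (B : choiceType)
    (u : {freeg B / A}) b : g 0 = 0 ->
  coeff b (\sum_(c <- dom u) << g (coeff c u) *g c >>) = g (coeff b u).
Proof.
move=> g0; rewrite raddf_sum /=; have [bu | bu] := boolP (b \in dom u).
  rewrite (bigD1_seq b) ?uniq_dom //= coeffU eqxx mulr1 big1 ?addr0 // => c nb.
  by rewrite coeffU (negPf nb) mulr0.
rewrite (coeff_outdom bu) g0 big_seq big1 // => c cu; rewrite coeffU.
by case: eqP => [eb | _]; [rewrite -eb cu in bu | rewrite mulr0].
Qed.

Lemma coeff_const_part (B : choiceType) (u : {freeg B / R}) b :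
  coeff b (const_part u) = (coeff b u)@_0.
Proof. exact: (coeff_map_dom (g := mcoeff 0%MM) u b (raddf0 _)). Qed.

Lemma const_part_is_zmod_morphism (B : choiceType) :
  zmod_morphism (@const_part K N B).
Proof.
move=> u v; apply/eqP/freeg_eqP => b.
by rewrite coeffB !coeff_const_part coeffB mcoeffB.
Qed.
HB.instance Definition _ (B : choiceType) :=
  GRing.isZmodMorphism.Build {freeg B / R} {freeg B / K} (@const_part K N B)
    (@const_part_is_zmod_morphism B).

Lemma const_partZ (B : choiceType) (p : R) (u : {freeg B / R}) :
  const_part (p *: u) = p@_0 *: const_part u.
Proof.
apply/eqP/freeg_eqP => b.
by rewrite coeffZ !coeff_const_part coeffZ (rmorphM (mcoeff 0)).
Qed.

Definition const_lift (B : choiceType) (u : {freeg B / K}) : {freeg B / R} :=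
  \sum_(b <- dom u) << (coeff b u)%:MP *g b >>.

Lemma coeff_const_lift (B : choiceType) (u : {freeg B / K}) b :
  coeff b (const_lift u) = (coeff b u)%:MP.
Proof. exact: (coeff_map_dom (g := @mpolyC N K) u b (raddf0 _)). Qed.

Lemma const_liftK (B : choiceType) : cancel (@const_lift B) (@const_part K N B).
Proof.
move=> u; apply/eqP/freeg_eqP => b.
by rewrite coeff_const_part coeff_const_lift mcoeffC eqxx mulr1.
Qed.

Lemma const_part_ksub w (B : choiceType) (deg : B -> int) s j
    (x : graded_free K N w deg) :
  ksub s j x -> const_part (x : {freeg B / R}) = 0.
Proof.
elim: s x => [|i s IH] x /=; first by move=> ->; exact: raddf0.
move=> [y _ /IH]; rewrite raddfB /= const_partZ mcoeffX mnm1_eq0.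
by rewrite scale0r subr0.
Qed.

(** A monomial other than 1 is divisible by some variable. With [const_part_ksub], this describes
    the kernel of [const_part]. *)
Lemma free_ksub_const_part w (B : choiceType) (deg : B -> int) s j
    (x : graded_free K N w deg) :
  (forall i, i \in s) -> x \in gm_homog (graded_free K N w deg) (j + w%:Z) ->
  const_part (x : {freeg B / R}) = 0 -> ksub s j x.
Proof.
move=> hs hx x0; apply: free_ksub => // b m hm.
suff: m != 0%MM.
  rewrite -mdeg_eq0 mdegE sum_nat_eq0 negb_forall => /existsP[i].
  by rewrite implyTb -lt0n; exists i.
apply: contra_neq hm => ->; rewrite -coeff_const_part.
by rewrite x0 coeff0.
Qed.

End ConstPart.

(** * From Koszul homology to Tor along a resolution *)

Section Resolution.
Context (K : fieldType) (N w : nat) (M : gradedModule K N w).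
Context (F : freeResolution M).
Local Notation R := {mpoly K[N]}.

Lemma const_part_diff p (u : res_mod F p.+1) :
  const_part (res_diff F p u) = tensor_diff (const_part (u : {freeg _ / R})).
Proof.
pose t := fglift (fun b : res_basis F p.+1 =>
  const_part (res_diff F p << b >>)).
have tL : linear t by exact: fglift_linear.
have tS I (r : seq I) (f : I -> {freeg (res_basis F p.+1) / K}) :
    t (\sum_(i <- r) f i) = \sum_(i <- r) t (f i).
  elim: r => [|i r IH]; last by rewrite !big_cons -IH -[f i]scale1r tL !scale1r.
  by rewrite !big_nil /t fglift_sum dom0 big_nil.
rewrite -[RHS]/(t _) tS -{1}(freeg_sumE u) !raddf_sum; apply: eq_bigr => b _.
rewrite /t liftU freegZU -const_partZ; congr const_part.
exact: (@linearZ_LR _ (res_mod F p.+1) (res_mod F p)).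
Qed.

Lemma const_part_homog j p (u : res_mod F p) :
  u \in gm_homog (res_mod F p) j ->
  const_part (u : {freeg _ / R}) \in @tensor_homog _ _ _ _ F p j.
Proof.
move=> /free_homogP hu; apply/allP => b; rewrite mem_dom coeff_const_part.
by apply: contraR => nj; rewrite hu // mdeg0 muln0 addr0.
Qed.

Lemma const_lift_homog j p (u : {freeg (res_basis F p) / K}) :
  u \in @tensor_homog _ _ _ _ F p j ->
  (const_lift N u : res_mod F p) \in gm_homog (res_mod F p) j.
Proof.
move=> /allP hu; apply/free_homogP => b m nj.
rewrite coeff_const_lift mcoeffC.
have [m0 | _] := eqVneq m 0%MM; last exact: mulr0.
rewrite mulr1; apply/eqP; move: nj; apply: contraR; rewrite -mem_dom => /hu.
by rewrite m0 mdeg0 muln0 addr0.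
Qed.

(** The augmentation serves as the differential out of F_0, so that the image of [res_map p] is the
    p-th syzygy module, with [M] itself for [p = 0]. *)
Definition res_target p : gradedModule K N w :=
  if p is q.+1 then res_mod F q else M.

Definition res_map p : {linear res_mod F p -> res_target p} :=
  match p return {linear res_mod F p -> res_target p} with
  | 0 => res_aug F
  | q.+1 => res_diff F q
  end.

Lemma res_map_hom p : graded_hom (res_map p).
Proof. by case: p => [|p]; [exact: res_aug_hom | exact: res_diff_hom]. Qed.

Lemma res_map_exact p : gexact (res_diff F p) (res_map p).
Proof.
have ex u : res_map p u = 0 <-> exists v, u = res_diff F p v.
  by case: p u => [|p] u; [exact: res_exact0 | exact: res_exactS].
split=> [y | j x hx /ex[v ev]]; first by apply/ex; exists y.
have [|v' hv' ev'] := @graded_hom_lift _ _ _ _ _ (res_diff F p) j v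
  (@res_diff_hom _ _ _ _ F p).
  by rewrite -ev.
by exists v' => //; rewrite ev.
Qed.

Lemma res_kexact_aug s q j : kexact M s q j -> kexact_im (res_map 0) s q j.
Proof.
apply: kexact_surj; first exact: res_map_hom.
move=> j' x hx; have [v ev] := res_aug_surj F x.
have [|v' hv' ev'] :=
  @graded_hom_lift _ _ _ _ _ (res_map 0) j' v (@res_map_hom 0).
  by rewrite /= ev.
by exists v' => //; rewrite -ev' /= ev.
Qed.

(** Iterating the shift [p] times relates exterior degree [q] on the p-th syzygy module to [p + q]
    on [M]. Each shift uses acyclicity of a free module, available in positive exterior degree;
    hence [q = 0] is allowed only for [p = 0]. *)
Lemma res_kexact s p q j : uniq s -> kexact M s (p + q) j ->
  (p = 0 \/ 0 < q)%N ->
  kexact_im (res_map p) s q (j + (p * w)%:Z).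
Proof.
move=> us h; elim: p q h => [|p IH] q h.
  by rewrite addr0 => _; exact: res_kexact_aug.
case: q h => [|q] h [] // _.
have -> : j + (p.+1 * w)%:Z = j + (p * w)%:Z + w%:Z by rewrite mulSn; lia.
apply: (@kexact_im_shift _ _ _ _ _ _ (res_map p.+1) (res_map p)).
- exact: res_map_hom.
- exact: res_map_exact.
- exact: free_kexact.
- by apply: IH; [rewrite addnS -addSn | right].
Qed.

(** Lift the cycle to [v] with constant coefficients. Koszul vanishing writes [v] as a cycle of the
    resolution plus an element [x] of (y_1, ..., y_N) F_p. The former is a boundary, and [x] dies
    modulo the variables. *)
Lemma res_kexact_boundary s p j (u : {freeg (res_basis F p) / K}) :
  uniq s -> (forall i, i \in s) -> kexact M s p j ->
  @tor_cycle _ _ _ _ F p (j + w%:Z + (p * w)%:Z) u ->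
  @tor_boundary _ _ _ _ F p (j + w%:Z + (p * w)%:Z) u.
Proof.
move=> us hs ex hu; set J := j + _ + _ in hu *.
have uJ : u \in @tensor_homog _ _ _ _ F p J by case: (p) u hu => [|q] u //= [].
have hv := const_lift_homog uJ; set v : res_mod F p := const_lift N u in hv *.
have khv : @khom _ _ _ (res_mod F p) s 0 J (kin s v) by apply/khom0P; exists v.
have eJ : J = j + (p * w)%:Z + w%:Z by rewrite /J addrAC.
have [y hy ey] : exists2 y : kos (res_mod F p) s, khom 1 (j + (p * w)%:Z) y &
    kmap (res_map p) (kin s v) = kmap (res_map p) (kdiff (fun i => 'X_i) y).
  case: p ex u @J eJ uJ hu @v hv khv => [|p] ex u J eJ uJ hu v hv khv.
    apply: (res_kexact us _ (or_introl (erefl 0%N))); rewrite ?addn0 -?eJ //.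
    rewrite -kmap_diff (kdiff_khom0 khv) kmap_0 //; exact: linear0.
  have [du cu] := hu.
  (* The cycle condition on [u] says that the differential of [v] vanishes modulo the variables. *)
  have : ksub s (j + (p * w)%:Z + w%:Z) (res_diff F p v).
    apply: free_ksub_const_part => //.
      have <- : J = j + (p * w)%:Z + w%:Z + w%:Z by rewrite eJ mulSn; lia.
      exact: (@res_diff_hom _ _ _ _ F p _ _ hv).
    by rewrite const_part_diff const_liftK.
  move=> /ksubP[y hy ey].
  have [||||z hz ez] := @kexact_shift _ _ _ _ _ _ (res_diff F p) (res_map p)
    s 0 (j + (p * w)%:Z) (kin s v) y.
  - exact: res_map_exact.
  - by apply: res_kexact => //; [rewrite addn1 | right].
  - exact: hy.
  - by rewrite kmap_kin ?ey //; exact: linear0.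
  by exists z => //; rewrite mulSn addnC PoszD addrA.
have [x hx exy] : exists2 x, x \in gm_homog (res_mod F p) J &
    kdiff (fun i => 'X_i) y = kin s x.
  by apply/khom0P; rewrite eJ; exact: khom_diff.
have xs : ksub s (j + (p * w)%:Z) x by apply/ksubP; exists y.
have [_ /(_ J (v - x))] := res_map_exact p.
case=> [||v' hv' ev'].
- exact: gm_homogB.
- apply/eqP; rewrite linearB subr_eq0; apply/eqP/(@kin_inj _ _ _ s).
  by rewrite -!kmap_kin ?linear0 // ey exy.
exists (const_part (v' : {freeg _ / R})); first exact: const_part_homog.
rewrite -const_part_diff -ev' raddfB /= (const_part_ksub xs) subr0.
by rewrite const_liftK.
Qed.

End Resolution.

(** * Vanishing outside the rows 0 to n - 1 *)

Theorem mainTheorem7 (K : fieldType) (n d k : nat)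
    (hn : (1 <= n)%N) (hd : (1 <= d)%N)
    (p : nat) (i : int) (hi : ~ (0 <= i <= n%:Z - 1)) :
  betti_is (veronese K n d k) p (k%:Z + (p%:Z + i) * d%:Z) 0.
Proof.
(* With the empty family as basis, it remains to show that every cycle is a boundary. *)
move=> F; exists (fun=> 0); split=> [[] // | u hu].
exists 0; split=> [|c _]; last by rewrite !thinmx0.
rewrite big_ord0 subr0.
(* The index for [kexact] is [k + (i - 1) d]: one [d] leads to the coefficients of the cycles, and
   [p * d] accounts for the exterior degree. *)
have eJ : k%:Z + (p%:Z + i) * d%:Z =
    k%:Z + (i - 1) * d%:Z + d%:Z + (p * d)%:Z by lia.
rewrite eJ in hu *; apply: (res_kexact_boundary _ _ _ hu).
- exact: veronese_vars_uniq.
- exact: mem_veronese_vars.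
- exact: veronese_kexact.
Qed.
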